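(* Let $\rho(r)$ be an arbitrary zero proximate order such that $\rho\left(\frac1r\right)=-\rho(r)$, let $V(r)=r^{\rho(r)}$, and let $$\gamma(t)=\sup_{r>0}\frac{V(tr)}{V(r)},\qquad t>0.$$ Then $$\lim_{t\to\infty}\frac{\ln\gamma(t)}{\ln t}=0,\qquad \lim_{t\to\infty}\frac{\ln\gamma\left(\frac1t\right)}{\ln t}=0 .$$
   Context: A proximate order (in the sense of Valiron) is a real function $\rho(r)$ on $(0,\infty)$, absolutely continuous (on every compact subinterval), such that: 1) $\lim_{r\to+\infty}\rho(r)=\rho(\infty)=\rho\in(-\infty,\infty)$; 2) $\lim_{r\to+\infty} r\ln r\,\rho'(r)=0$, where $\rho'(r)$ denotes the derived number of $\rho$ at $r$ of largest modulus. It is called a zero proximate order if $\lim_{r\to\infty}\rho(r)=0$. *)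

(* Defs.v *)
From mathcomp Require Import all_boot all_order all_algebra.
From mathcomp Require Import all_classical all_reals all_analysis.

Set Implicit Arguments.
Unset Strict Implicit.
Unset Printing Implicit Defensive.

Import Order.TTheory GRing.Theory Num.Theory.
Import numFieldNormedType.Exports.

Local Open Scope classical_set_scope.
Local Open Scope ring_scope.

Definition absolutely_continuous_on (R : realType) (a b : R) (f : R -> R) : Prop :=
  forall eps : R, 0 < eps -> exists2 delta : R, 0 < delta &
    forall (n : nat) (u v : 'I_n -> R),
      (forall i, [/\ a <= u i, u i <= v i & v i <= b]) ->
      trivIset setT (fun i => `]u i, v i[%classic) ->
      \sum_(i < n) (v i - u i) < delta ->
      \sum_(i < n) `|f (v i) - f (u i)| < eps.

(* Derived numbers are extended reals: the infinite values are allowed. *)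
Definition derived_number (R : realType) (f : R -> R) (r : R) (l : \bar R) : Prop :=
  exists h : nat -> R,
    [/\ forall n, h n != 0,
        h n @[n --> \oo] --> (0 : R) &
        ((f (r + h n) - f r) / h n)%:E @[n --> \oo] --> l].

Definition largest_derived_number (R : realType) (f : R -> R) (r : R)
    (l : \bar R) : Prop :=
  derived_number f r l /\
  forall l', derived_number f r l' -> (`|l'| <= `|l|)%E.

(* [rho'] is unique up to sign at each point, so the last condition does not
   depend on which derived number of largest modulus is selected. It forces
   [rho' r] to be finite for large [r]. Values of [rho] outside ]0, +oo[ are
   irrelevant. *)
Definition proximate_order (R : realType) (rho : R -> R) : Prop :=
  [/\ forall a b : R, 0 < a -> a <= b -> absolutely_continuous_on a b rho,
      exists l : R, rho r @[r --> +oo%R] --> l &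
      exists2 rho' : R -> \bar R,
        forall r, 0 < r -> largest_derived_number rho r (rho' r) &
        ((r * ln r)%:E * rho' r)%E @[r --> +oo%R] --> 0%E].

Definition zero_proximate_order (R : realType) (rho : R -> R) : Prop :=
  proximate_order rho /\ rho r @[r --> +oo%R] --> (0 : R).

Definition order_power (R : realType) (rho : R -> R) (r : R) : R := r `^ rho r.

(* The supremum is taken in \bar R, so no finiteness is presupposed. *)
Definition dilation_sup (R : realType) (V : R -> R) (t : R) : \bar R :=
  ereal_sup [set (V (t * r) / V r)%:E | r in [set r : R | 0 < r]].

(* Main.v *)
Require Import Defs.
From mathcomp Require Import all_boot all_order all_algebra.
From mathcomp Require Import all_classical all_reals all_analysis.
From mathcomp Require Import ring lra.

(** In the variable x = ln r the function W = ln V = rho * ln becomes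
    g(x) = x * rho(e^x).  The symmetry of rho makes g even, and the two
    conditions on a zero proximate order say that g' = rho + r ln r rho'
    tends to 0 at infinity.  So for every eps > 0 the function g is
    eps-Lipschitz outside a compact set, on which it is bounded, whence
    |g(x + s) - g(x)| <= C + eps |s| for all x and s
    ([zero_proximate_order_quasi_lipschitz]).  As V(t r) / V(r) is the
    exponential of g(x + ln t) - g(x), the supremum gamma(t) lies between
    exp(- C - eps |ln t|) and exp(C + eps |ln t|), and this treats t and 1/t
    alike; dividing ln gamma by ln t gives both limits.

    The work lies in the Lipschitz bound near infinity, as rho' is only a
    derived number of largest modulus.  Compactness of the extended line turns
    a bound on that number into a bound on all increments from the point
    ([largest_derived_number_near]); after comparison of increments of r with
    increments of ln r this says that W is locally dominated by eps * ln, and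
    a supremum argument ([locally_dominated_increment]) passes from local to
    global domination without differentiating anything.  Absolute continuity
    only enters through the boundedness of rho on a compact interval. *)

Import Order.TTheory GRing.Theory Num.Theory.
Import numFieldNormedType.Exports.

Local Open Scope classical_set_scope.
Local Open Scope ring_scope.

(** * From derived numbers to increments *)

(** The order-preserving homeomorphism [contract] onto [-1, 1] reduces the claim
    to bounded real sequences. *)
Lemma ereal_bolzano_weierstrass (R : realType) (q : nat -> \bar R) :
  exists (f : nat -> nat) (l : \bar R),
    increasing_seq f /\ q (f n) @[n --> \oo] --> l.
Proof.
have [|f fincr /cvg_ex[/= c qc]] := @bolzano_weierstrass R (@contract R \o q).
  by exists 1; split => // M M1 n _ /=; rewrite (le_trans (contract_le1 _)) ?ltW.
have c1 : `|c| <= 1.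
  apply: (cvgr_to_le (cvg_norm qc)); apply: nearW => n; exact: contract_le1.
exists f, (expand c); split => //.
apply/cvg_ballP => e e0.
move/cvgrPdist_lt : qc => /(_ e e0).
apply: filterS => n /=.
rewrite /ball /= /ereal_ball expandK //.
Qed.

(** If the increments exceeded [k * `|h|] for arbitrarily small [h], the
    difference quotients would have a limit point in the extended line of
    modulus at least [k]: a derived number larger than the largest one. *)
Lemma largest_derived_number_near (R : realType) (f : R -> R) (r k : R)
    (l : \bar R) :
  largest_derived_number f r l -> (`|l| < k%:E)%E ->
  \forall h \near (0 : R), `|f (r + h) - f r| <= k * `|h|.
Proof.
move=> [_ lmax] lk; apply: contrapT => nH.
have far n : exists h : R, `|h| < n.+1%:R^-1 /\ k * `|h| < `|f (r + h) - f r|.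
  apply: contrapT => nh; apply: nH.
  have n0 : 0 < n.+1%:R^-1 :> R by rewrite invr_gt0.
  apply: filterS (nbhs0_lt n0) => h hn.
  by rewrite leNgt; apply/negP => khf; apply: nh; exists h.
have [h hP] := choice far.
have h0 n : h n != 0.
  apply/eqP => hn; have := (hP n).2.
  by rewrite hn addr0 subrr normr0 mulr0 ltxx.
pose q n := ((f (r + h n) - f r) / h n)%:E.
have [s [m [sincr qm]]] := ereal_bolzano_weierstrass _ q.
have s_ge n : (n <= s n)%N.
  elim: n => // n IH; apply: (leq_ltn_trans IH).
  by move/increasing_seqP : sincr; apply.
suff dm : derived_number f r m.
  have km : (k%:E <= `|m|)%E.
    apply: (cvge_to_ge (cvg_abse qm)); apply: nearW => n /=.
    rewrite lee_fin normrM normfV ler_pdivlMr ?normr_gt0 ?h0//.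
    exact: ltW (hP _).2.
  by have := le_lt_trans (le_trans km (lmax _ dm)) lk; rewrite ltxx.
exists (h \o s); split => //=.
apply/cvgr0Pnorm_lt => e e0.
have [N _ HN] := near_infty_natSinv_lt (PosNum e0).
exists N => // n /= Nn; apply: lt_le_trans (hP _).1 _.
rewrite (le_trans _ (ltW (HN n Nn)))//= lef_pV2 ?posrE// ler_nat ltnS.
exact: s_ge.
Qed.

(** A mean value inequality without derivatives.  Let [c] be the supremum of the
    points [x] up to which the inequality holds from [a]: the
    local bound at [c], used to the left, shows that [c] is such a point, and
    used to the right that nothing stops at [c] unless [c = b]. *)
Lemma locally_dominated_increment (R : realType) (F G : R -> R) (a b : R) :
  a <= b ->
  {in `[a, b] &, {homo G : x y / x <= y}} ->
  (forall x, a <= x <= b ->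
    \forall y \near x, `|F y - F x| <= `|G y - G x|) ->
  `|F b - F a| <= G b - G a.
Proof.
move=> ab Gmono loc.
pose S := [set x : R | a <= x <= b /\ `|F x - F a| <= G x - G a].
have Sa : S a by split; rewrite ?lexx ?ab// !subrr normr0.
have Sub : ubound S b by move=> x [/andP[]].
have hasS : has_sup S by split; [exists a|exists b].
have step x y : a <= x -> x <= y -> y <= b -> S x ->
    `|F y - F x| <= `|G y - G x| -> S y.
  move=> ax xy yb [_ Sx] Fxy; split; first by rewrite (le_trans ax).
  have xi : x \in `[a, b] by rewrite in_itv/= ax (le_trans xy).
  have yi : y \in `[a, b] by rewrite in_itv/= yb (le_trans ax).
  have Gxy := Gmono _ _ xi yi xy.
  rewrite (ger0_norm (_ : 0 <= G y - G x)) ?subr_ge0// in Fxy.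
  have := ler_normD (F y - F x) (F x - F a).
  rewrite [X in `|X|](_ : _ = F y - F a); last by ring.
  by move=> tri; lra.
set c := sup S.
have ac : a <= c by apply: ub_le_sup => //; exists b.
have cb : c <= b by apply: ge_sup => //; exists a.
have acb : a <= c <= b by rewrite ac.
have /nbhs_ballP[d /= d0 cd] := loc c acb.
have Sc : S c.
  have [x Sx cx] := sup_adherent d0 hasS.
  have xc : x <= c by apply: ub_le_sup => //; exists b.
  have := Sx.1 => /andP[ax xb].
  apply: (step x c) => //; rewrite distrC [leRHS]distrC; apply: cd.
  by rewrite /ball/= ger0_norm ?subr_ge0//; move: cx; rewrite -/c; lra.
suff -> : b = c by case: Sc.
apply/eqP; rewrite eq_le cb andbT leNgt; apply/negP => cltb.
pose y := Num.min b (c + d / 2).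
have cy : c < y by rewrite lt_min cltb ltrDl divr_gt0.
have yd : y <= c + d / 2 by rewrite ge_min lexx orbT.
have yb : y <= b by rewrite ge_min lexx.
suff Sy : S y.
  have : y <= c by apply: ub_le_sup => //; exists b.
  by rewrite leNgt cy.
apply: (step c y) => //; first exact: ltW.
apply: cd; rewrite /ball/= distrC ger0_norm ?subr_ge0 ?(ltW cy)//.
lra.
Qed.

(** * The logarithm of V in logarithmic coordinates *)
Lemma mul_ln_diff_le (R : realType) (x y : R) :
  0 < x -> 0 < y -> x * (ln y - ln x) <= y - x.
Proof.
move=> x0 y0; rewrite -ler_pdivlMl// mulrC -ln_div ?posrE//.
have -> : (y - x) / x = y / x - 1 by field; rewrite gt_eqF.
have := @le_ln1Dx _ (y / x - 1).
rewrite addrCA subrr addr0; apply.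
by rewrite ltrBDr addrC subrr divr_gt0.
Qed.

(** The derivative of [ln] is at least [1 / (2 x)] between 0 and [2 x]; this
    is what converts bounds in terms of [`|y - x|] into bounds in terms of
    [`|ln y - ln x|]. *)
Lemma dist_le_mul_dist_ln (R : realType) (x y : R) :
  0 < x -> 0 < y -> y <= 2 * x -> `|y - x| <= 2 * x * `|ln y - ln x|.
Proof.
move=> x0 y0 yx; have [xy|yx'] := leP x y.
  have lnxy : ln x <= ln y by rewrite ler_ln ?posrE.
  rewrite !ger0_norm ?subr_ge0//.
  have := mul_ln_diff_le _ _ _ y0 x0.
  have : y * (ln y - ln x) <= 2 * x * (ln y - ln x).
    by rewrite ler_wpM2r// subr_ge0.
  by move=> ? ?; lra.
have lnyx : ln y <= ln x by rewrite ler_ln ?posrE// ltW.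
rewrite !ler0_norm ?subr_le0 ?(ltW yx')//.
have := mul_ln_diff_le _ _ _ x0 y0.
have : 0 <= x * (ln x - ln y) by rewrite mulr_ge0 ?subr_ge0// ltW.
by move=> ? ?; lra.
Qed.

(** Here [W y - W x = (rho y - rho x) ln x + rho y (ln y - ln x)].  The second
    term is small because [rho] tends to 0, the first because increments of
    [rho] at [x] are at most [eps / (4 x ln x)] times those of the variable. *)
Lemma zero_proximate_order_log_lipschitz (R : realType) (rho : R -> R)
    (eps : R) :
  zero_proximate_order rho -> 0 < eps ->
  exists2 A : R, 1 <= A & forall s t, A <= s -> s <= t ->
    `|rho t * ln t - rho s * ln s| <= eps * (ln t - ln s).
Proof.
move=> [[_ _ [rho' rho'P rho'0]] rho0] eps0.
have eps2 : 0 < eps / 2 by rewrite divr_gt0.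
have eps4 : 0 < eps / 4 by rewrite divr_gt0.
have [M1 [_ rhoM]] := (cvgr0Pnorm_lt _).1 rho0 _ eps2.
have : \forall r \near +oo, (`|(r * ln r)%:E * rho' r| < (eps / 4)%:E)%E.
  have /fine_cvgP[fin] :
      (`|(r * ln r)%:E * rho' r|)%E @[r --> +oo] --> (0 : R)%:E.
    by rewrite -[0%:E]abse0; exact: cvg_abse rho'0.
  move=> /cvgr0Pnorm_lt /(_ _ eps4); apply: filterS2 fin => r /= rfin.
  by rewrite -lte_fin -abse_EFin fineK // abse_id.
move=> [M2 [_ rhoM']].
(* The margin 1 keeps a whole neighbourhood of every x >= A in the range of
   the two asymptotic bounds, and 2 <= A gives y < x + 1 <= 2 x there. *)
pose A := Num.max 1 (Num.max M1 M2) + 1.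
have AM x : A - 1 <= x -> [/\ 1 <= x, M1 <= x & M2 <= x].
  rewrite /A addrK !ge_max => /andP[-> /andP[-> ->]] //.
have A1 : 2 <= A by rewrite /A -[2]/(1 + 1) lerD2r le_max lexx.
exists A; first by apply: le_trans A1; lra.
move=> s t As st.
rewrite mulrBr.
apply: (locally_dominated_increment _ (fun x => rho x * ln x)
  (fun x => eps * ln x)) => //.
  move=> x y; rewrite !in_itv/= => /andP[sx _] _ xy.
  rewrite ler_pM2l// ler_ln ?posrE//; lra.
move=> x /andP[sx _]; have Ax : A <= x by exact: le_trans sx.
have x0 : 0 < x by lra.
have lnx0 : 0 < ln x by rewrite ln_gt0; lra.
have c0 : 0 < x * ln x by exact: mulr_gt0.
have small : (`|rho' x| < ((x * ln x)^-1 * (eps / 4))%:E)%E.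
  have := rhoM' x; rewrite abseM abse_EFin gtr0_norm//.
  rewrite [(_^-1 * _)%:E]EFinM lte_pdivlMl//; apply.
  by have [] := AM (x - 1) _; lra.
have /nbhs_ballP[d /= d0 near_x] :=
  largest_derived_number_near _ _ _ _ _ (rho'P x x0) small.
apply/nbhs_ballP; exists (Num.min d 1) => /=; first by rewrite lt_min d0 ltr01.
move=> y; rewrite /ball/= lt_min distrC => /andP[yd yx1].
have [yx1' xy1'] : x - 1 < y /\ y < x + 1.
  by move: yx1; rewrite ltr_norml => /andP[? ?]; split; lra.
have y0 : 0 < y by lra.
have := near_x (y - x); rewrite /ball/= sub0r normrN addrCA subrr addr0.
move=> /(_ yd) inc.
have rhoy : `|rho y| <= eps / 2.
  by apply/ltW/rhoM; have [] := AM (x - 1) _; lra.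
have ln_inc := dist_le_mul_dist_ln _ _ _ x0 y0 _.
have {}ln_inc : `|y - x| <= 2 * x * `|ln y - ln x| by apply: ln_inc; lra.
have -> : rho y * ln y - rho x * ln x =
  (rho y - rho x) * ln x + rho y * (ln y - ln x) by ring.
rewrite -mulrBr normrM (gtr0_norm eps0) (le_trans (ler_normD _ _))// !normrM.
rewrite (gtr0_norm lnx0) [leRHS](_ : _ =
  eps / 2 * `|ln y - ln x| + eps / 2 * `|ln y - ln x|); last by field.
apply: lerD; last by rewrite ler_wpM2r.
apply: (le_trans (ler_wpM2r (ltW lnx0) inc)).
have -> : (x * ln x)^-1 * (eps / 4) * `|y - x| * ln x =
  eps / 4 / x * `|y - x| by field; rewrite !gt_eqF.
apply: (le_trans (ler_wpM2l _ ln_inc)); first by rewrite divr_ge0 ?ltW.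
by rewrite le_eqVlt; apply/orP; left; apply/eqP; field; rewrite gt_eqF.
Qed.

(** Absolute continuity with families of one interval is uniform continuity. *)
Lemma absolutely_continuous_on_bounded (R : realType) (a b : R) (f : R -> R) :
  absolutely_continuous_on a b f ->
  exists M : R, forall x, a <= x <= b -> `|f x| <= M.
Proof.
move=> fac.
have fcont : {within `[a, b], continuous f}.
  apply/subspace_continuousP => x; rewrite /= in_itv/= => /andP[ax xb].
  apply/cvgrPdist_lt => e /fac[d d0 fd].
  rewrite near_withinE; apply/nbhs_ballP; exists d => //= y xyd.
  rewrite in_itv/= => /andP[ay yb].
  wlog xy : x y ax xb ay yb xyd / x <= y.
    move=> H; have [|/ltW] := leP x y; first exact: H.
    by rewrite distrC; apply: H => //; exact: ball_sym.
  have := fd 1%N (fun=> x) (fun=> y); rewrite !big_ord1 distrC; apply => //.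
    by move=> i j _ _ _; rewrite (ord1 i) (ord1 j).
  by move: xyd; rewrite /ball/= distrC ger0_norm// subr_ge0.
have /compact_bounded[M [_ HM]] := continuous_compact fcont (@segment_compact _ a b).
exists (M + 1) => x xab; apply: HM; first by rewrite ltrDl.
by exists x => //=; rewrite in_itv.
Qed.

(** Outside [1/A, A] the previous Lipschitz bound applies on either side by
    symmetry; the constant [C] absorbs the variation of [W] on [1/A, A]. *)
Lemma zero_proximate_order_quasi_lipschitz (R : realType) (rho : R -> R)
    (eps : R) :
  zero_proximate_order rho ->
  (forall r, 0 < r -> rho (1 / r) = - rho r) -> 0 < eps ->
  exists2 C : R, 0 <= C & forall r s, 0 < r -> 0 < s ->
    `|rho s * ln s - rho r * ln r| <= C + eps * `|ln s - ln r|.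
Proof.
move=> zpo hsym eps0.
have [A A1 tail] := zero_proximate_order_log_lipschitz _ _ _ zpo eps0.
have [M rhoM] : exists M : R, forall x, 1 <= x <= A -> `|rho x| <= M.
  by case: zpo => [[ac _ _] _]; apply/absolutely_continuous_on_bounded/ac.
pose W r := rho r * ln r.
have lnA : 0 <= ln A by exact: ln_ge0.
have M0 : 0 <= M by apply: le_trans (rhoM 1 _); rewrite ?lexx.
have WM x : 1 <= x <= A -> `|W x| <= M * ln A.
  move=> /[dup] /andP[x1 xA] /rhoM rx.
  rewrite normrM ler_pM// ger0_norm ?ln_ge0// ler_ln ?posrE//; lra.
have MA0 : 0 <= M * ln A by exact: mulr_ge0.
(* If x <= A < y the increment is split at A. *)
have far x y : 1 <= x -> 1 <= y ->
    `|W y - W x| <= 4 * (M * ln A) + eps * `|ln y - ln x|.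
  wlog xy : x y / x <= y.
    move=> H x1 y1; have [|/ltW] := leP x y; first by move/H; apply.
    by rewrite distrC [`|ln _ - _|]distrC; move/H; apply.
  move=> x1 y1.
  have lnxy : ln x <= ln y by rewrite ler_ln ?posrE//; lra.
  rewrite [`|ln _ - _|]ger0_norm ?subr_ge0//.
  have e0 : 0 <= eps * (ln y - ln x) by rewrite mulr_ge0 ?subr_ge0// ltW.
  have [Ax|xA] := leP A x; first by apply: (le_trans (tail _ _ Ax xy)); lra.
  have Wx := WM x; have WA := WM A; rewrite lexx andbT in WA.
  have {}Wx : `|W x| <= M * ln A by apply: Wx; rewrite x1 ltW.
  have {}WA : `|W A| <= M * ln A by apply: WA.
  have [yA|Ay] := leP y A.
    have Wy : `|W y| <= M * ln A by apply: WM; rewrite y1.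
    by apply: (le_trans (ler_normB _ _)); lra.
  have WyA := tail _ _ (lexx A) (ltW Ay).
  have lnxA : ln x <= ln A by rewrite ler_ln ?posrE//; lra.
  have e1 : eps * (ln y - ln A) <= eps * (ln y - ln x) by rewrite ler_pM2l//; lra.
  have -> : W y - W x = (W y - W A) + (W A - W x) by ring.
  apply: (le_trans (ler_normD _ _)).
  have := ler_normB (W A) (W x).
  rewrite -/(W y) -/(W A) in WyA; lra.
(* W is even in ln r, so r may be replaced by max(r, 1/r). *)
have WV r : 0 < r -> exists2 x, 1 <= x & W x = W r /\ ln x = `|ln r|.
  move=> r0; have [r1|r1] := leP 1 r.
    by exists r => //; split => //; rewrite ger0_norm ?ln_ge0.
  have lr : ln r <= 0 by apply: ln_le0; exact: ltW.
  exists (1 / r); first by rewrite div1r invf_ge1// ltW.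
  by split; rewrite /W ?hsym// div1r lnV ?posrE// ?mulrNN ?ler0_norm.
exists (4 * (M * ln A)); first by rewrite mulr_ge0.
move=> r s r0 s0; rewrite -/(W r) -/(W s).
have [x x1 [<- lx]] := WV r r0.
have [y y1 [<- ly]] := WV s s0.
apply: (le_trans (far x y x1 y1)).
rewrite lerD2l ler_pM2l// lx ly; exact: ler_dist_dist.
Qed.

(** * The dilation function *)

(** Each ratio [V (t * r) / V r] lies between [expR (- B)] and [expR B], hence so
    does their supremum; its lower bound needs a single [r]. *)
Lemma dilation_sup_order_power_bounds (R : realType) (rho : R -> R)
    (t B : R) :
  0 < t ->
  (forall r, 0 < r -> `|rho (t * r) * ln (t * r) - rho r * ln r| <= B) ->
  exists2 g : R, 0 < g &
    dilation_sup (order_power rho) t = g%:E /\ `|ln g| <= B.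
Proof.
move=> t0 HB.
have ratio r : 0 < r -> order_power rho (t * r) / order_power rho r =
    expR (rho (t * r) * ln (t * r) - rho r * ln r).
  move=> r0; rewrite /order_power.
  by rewrite expRD expRN -!ln_powR !lnK ?posrE ?powR_gt0 ?mulr_gt0.
set G := dilation_sup _ _.
have Gub : (G <= (expR B)%:E)%E.
  apply: ge_ereal_sup => _ [r /= r0 <-].
  rewrite lee_fin ratio// ler_expR.
  by have := HB r r0; rewrite ler_norml => /andP[].
have Glb : ((expR (- B))%:E <= G)%E.
  apply: le_trans (ereal_sup_ubound _); last by exists 1; first exact: ltr01.
  rewrite lee_fin ratio// ler_expR.
  by have := HB 1 ltr01; rewrite ler_norml => /andP[].
have Gfin : G \is a fin_num.
  by rewrite fin_numElt (lt_le_trans (ltNyr _) Glb) (le_lt_trans Gub (ltry _)).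
move: Gub Glb; rewrite -(fineK Gfin) !lee_fin => Gub Glb.
have G0 : 0 < fine G by apply: lt_le_trans Glb; exact: expR_gt0.
exists (fine G) => //; split => //.
rewrite ler_norml; apply/andP; split.
  by rewrite -[leLHS]expRK ler_ln ?posrE ?expR_gt0.
by rewrite -[leRHS]expRK ler_ln ?posrE ?expR_gt0.
Qed.

(** A quantity bounded by [C + eps * ln t] for every [eps], with [C] depending on
    [eps], is [o(ln t)]: half of the tolerance goes to [eps], and the other half
    absorbs [C] once [ln t > 2 C / e]. *)
Lemma cvg_lne_div_ln0 (R : realType) (u : R -> \bar R) :
  (forall eps : R, 0 < eps -> exists2 C : R, 0 <= C & forall t, 1 < t ->
    exists2 g : R, 0 < g & u t = g%:E /\ `|ln g| <= C + eps * ln t) ->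
  (lne (u t) / (ln t)%:E)%E @[t --> +oo%R] --> 0%E.
Proof.
move=> H.
have value t : 1 < t -> exists2 g : R, 0 < g & u t = g%:E /\
    (lne (u t) / (ln t)%:E)%E = (ln g / ln t)%:E.
  move=> t1; have [C _ /(_ t t1)[g g0 [ug _]]] := H 1 ltr01.
  exists g => //; split => //.
  by rewrite ug lne_EFin// inver gt_eqF ?ln_gt0// EFinM.
apply/fine_cvgP; split.
  exists 1; split => // t t1.
  by have [g _ [_ ->]] := value t t1.
apply/cvgr0Pnorm_lt => e e0.
have e2 : 0 < e / 2 by rewrite divr_gt0.
have [C C0 HC] := H _ e2.
exists (expR (2 * C / e)); split => // t tbig.
have t1 : 1 < t.
  apply: le_lt_trans tbig; rewrite -expR0 ler_expR.
  by rewrite divr_ge0 ?mulr_ge0// ltW.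
have lnt : 0 < ln t by exact: ln_gt0.
have Clnt : C < e / 2 * ln t.
  have : 2 * C / e < ln t.
    rewrite -ltr_expR lnK ?posrE//; lra.
  rewrite mulrAC -ltr_pdivrMl // invf_div => ?; lra.
have [g g0 [ug lg]] := HC t t1.
have [g' _ [ug' uval]] := value t t1.
have gg' : g' = g by move: ug'; rewrite ug => -[].
rewrite /= uval gg' /= normrM normfV (gtr0_norm lnt) ltr_pdivrMr//.
lra.
Qed.

Theorem theorem2p5 (R : realType) (rho : R -> R)
    (hrho : zero_proximate_order rho)
    (hsym : forall r : R, 0 < r -> rho (1 / r) = - rho r) :
  let gamma := dilation_sup (order_power rho) in
  ((lne (gamma t) / (ln t)%:E)%E @[t --> +oo%R] --> 0%E) /\
  ((lne (gamma (1 / t)%R) / (ln t)%:E)%E @[t --> +oo%R] --> 0%E).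
Proof.
move=> gamma.
have bound eps : 0 < eps -> exists2 C : R, 0 <= C & forall t, 0 < t ->
    exists2 g : R, 0 < g & gamma t = g%:E /\ `|ln g| <= C + eps * `|ln t|.
  move=> eps0.
  have [C C0 HC] := zero_proximate_order_quasi_lipschitz _ _ _ hrho hsym eps0.
  exists C => // t t0; apply: dilation_sup_order_power_bounds => // r r0.
  have := HC r (t * r) r0 (mulr_gt0 t0 r0).
  by rewrite [in X in _ <= X]lnM ?posrE// addrK.
split; apply: cvg_lne_div_ln0 => eps /bound[C C0 HC]; exists C => // t t1;
  have t0 : 0 < t by lra.
  by have := HC t t0; rewrite ger0_norm// ln_ge0// ltW.
have := HC (1 / t); rewrite div1r lnV ?posrE// normrN invr_gt0.
by move=> /(_ t0); rewrite ger0_norm// ln_ge0// ltW.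
Qed.
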